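(* Let $k\ge 1$ be an integer. If $k+1$ is coprime with $6$, then $f(k)=\frac{k}{4}$.
   Context: Let $P\subset\mathbb{Z}^2$ be a finite set of grid points. There are four directions: horizontal $(1,0)$, vertical $(0,1)$, and the two diagonals $(1,1)$ and $(1,-1)$. For a direction $d$ and an integer $k\ge 1$, a line segment of length $k$ of $P$ in direction $d$ is a set $\{p,p+d,\dots,p+(k-1)d\}\subseteq P$ such that $p-d\notin P$ and $p+kd\notin P$ (a maximal run of exactly $k$ points). Segments are counted separately for each direction, so that an isolated point gives $4$ line segments of length $1$. For integers $k,n\ge 1$, $a_k(n)$ denotes the minimal cardinality of a finite set $P\subset\mathbb{Z}^2$ that has at least $n$ line segments of length $k$ (counted over all four directions). Define $f(k)=\lim_{n\to\infty}\frac{a_k(n)}{n}$; this limit exists for every $k\ge 1$. *)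

(* Defs.v *)
From HB Require Import structures.
From mathcomp Require Import all_boot all_order all_algebra.
From mathcomp Require Import finmap.
From mathcomp Require Import all_classical all_reals all_analysis.

Set Implicit Arguments.
Unset Strict Implicit.
Unset Printing Implicit Defensive.

Import Order.TTheory GRing.Theory Num.Theory.
Import numFieldNormedType.Exports.

Local Open Scope fset_scope.
Local Open Scope classical_set_scope.
Local Open Scope ring_scope.

Definition grid_point := (int * int)%type.

Definition directions : seq grid_point :=
  [:: (1, 0); (0, 1); (1, 1); (1, -1)].

Definition run (d : grid_point) (k : nat) (p : grid_point) : {fset grid_point} :=
  [fset p + d *+ i | i in iota 0 k].

Definition maximal_run (P : {fset grid_point}) (d : grid_point) (k : nat)
    (p : grid_point) : bool :=
  [&& (run d k p `<=` P)%fset, p - d \notin P & p + d *+ k \notin P].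

(* For k >= 1 a maximal run starts at a point of P, so ranging over p in P     *)
(* loses nothing.                                                              *)
Definition segments (P : {fset grid_point}) (d : grid_point) (k : nat) :
    {fset {fset grid_point}} :=
  [fset run d k p | p in P & maximal_run P d k p].

Definition nb_segments (k : nat) (P : {fset grid_point}) : nat :=
  (\sum_(d <- directions) #|` segments P d k|)%N.

Definition attainable (k n : nat) : pred nat := fun m =>
  `[< exists2 P : {fset grid_point}, #|` P| = m & (n <= nb_segments k P)%N >].

Lemma attainable_ex (k n : nat) : (0 < k)%N -> exists m, attainable k n m.
Proof.
move=> k_gt0.
pose P : {fset grid_point} :=
  [fset ((i%:Z, (j.*2)%:Z) : grid_point) | i in iota 0 k, j in iota 0 n].
have inP (x y : int) : ((x, y) \in P) ->
    exists i j, [/\ (i < k)%N, (j < n)%N, x = i%:Z & y = (j.*2)%:Z].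
  move=> /imfset2P[i /=]; rewrite mem_iota => ik [j /=].
  by rewrite mem_iota => jn [-> ->]; exists i, j; case/andP: ik; case/andP: jn.
have Pin i j : (i < k)%N -> (j < n)%N -> ((i%:Z, (j.*2)%:Z) : grid_point) \in P.
  move=> ik jn; apply/imfset2P; exists i; rewrite /= ?mem_iota //.
  by exists j; rewrite /= ?mem_iota.
have shift (y : int) i j :
    ((i%:Z, y) : grid_point) + (1, 0) *+ j = ((i + j)%N%:Z, y).
  elim: j => [|j IH]; first by rewrite mulr0n addr0 addn0.
  by rewrite mulrSr addrA IH addnS -addn1 PoszD; congr pair; rewrite /= addr0.
have Pmax j : (j < n)%N -> maximal_run P (1, 0) k (0%:Z, (j.*2)%:Z).
  move=> jn; apply/and3P; split.
  - apply/fsubsetP => q /imfsetP[i]; rewrite /= mem_iota => /andP[_ ik] ->.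
    by rewrite shift add0n Pin.
  - by apply/negP => /inP[i [l [_ _]]].
  - rewrite shift add0n; apply/negP => /inP[i [l [ik _ [ki] _]]].
    by move: ik; rewrite -ki ltnn.
exists #|` P|; apply/asboolP; exists P => //.
rewrite /nb_segments big_cons.
apply: leq_trans (leq_addr _ _).
pose S : {fset {fset grid_point}} :=
  [fset run (1, 0) k ((0%:Z, (j.*2)%:Z) : grid_point) | j in iota 0 n].
have -> : n = #|` S|.
  rewrite card_in_imfset /=; first by rewrite (undup_id (iota_uniq _ _)) size_iota.
  move=> j l _ _ jl.
  have : ((0%:Z, (j.*2)%:Z) : grid_point) \in run (1, 0) k (0%:Z, (l.*2)%:Z).
    by rewrite -jl; apply/imfsetP; exists 0%N; rewrite /= ?mem_iota ?mulr0n ?addr0.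
  move=> /imfsetP[i _]; rewrite shift => -[_ /eqP].
  by rewrite -!muln2 eqn_pmul2r // => /eqP.
apply: fsubset_leq_card; apply/fsubsetP => s /imfsetP[j].
rewrite /= mem_iota => /andP[_ jn] ->.
apply/imfsetP; exists (0%:Z, (j.*2)%:Z) => //=.
by rewrite !inE /= Pmax // Pin.
Qed.

(* min_points k n is a_k(n). It is a genuine minimum for k >= 1, see           *)
(* min_points_min; the value for k = 0 is irrelevant.                          *)
Definition min_points (k n : nat) : nat :=
  if pselect (exists m, attainable k n m) is left ex then ex_minn ex else 0%N.

Lemma min_points_min (k n : nat) : (0 < k)%N ->
  (exists2 P : {fset grid_point},
    #|` P| = min_points k n & (n <= nb_segments k P)%N) /\
  (forall P : {fset grid_point},
    (n <= nb_segments k P)%N -> (min_points k n <= #|` P|)%N).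
Proof.
move=> k_gt0; rewrite /min_points; case: pselect => [ex|]; last first.
  by move=> /(_ (attainable_ex n k_gt0)).
case: ex_minnP => m /asboolP mP m_min; split=> // P nP.
by apply: m_min; apply/asboolP; exists P.
Qed.

(* The term at n = 0 is 0 by the convention x / 0 = 0.                          *)
Definition points_per_segment (R : realType) (k : nat) : R^nat :=
  fun n => (min_points k n)%:R / n%:R.

Definition f (R : realType) (k : nat) : R := limn (points_per_segment R k).

(* Main.v *)
(** Two maximal runs of length k in the same direction are disjoint, so over
    the four directions there are at most 4 |P| / k of them and f k >= k / 4.
    Conversely, if k + 1 is coprime with 6, then x + 2 y changes by 1, 2, 3 or
    -1, a unit modulo k + 1, along each direction: removing the points with
    k + 1 | x + 2 y cuts every line into runs of length k.  In an N x N portion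
    of this pattern only O(N) runs are spoiled by the boundary. *)

Require Import Defs.
From mathcomp Require Import all_boot all_order all_algebra.
From mathcomp Require Import finmap.
From mathcomp Require Import all_classical all_reals all_analysis.
From mathcomp Require Import zify lra.

Set Implicit Arguments.
Unset Strict Implicit.
Unset Printing Implicit Defensive.

Import Order.TTheory GRing.Theory Num.Theory.
Import numFieldNormedType.Exports.

Local Open Scope classical_set_scope.
Local Open Scope ring_scope.

(** * Disjointness of runs and counting segments *)

Lemma mem_run (d : grid_point) (k i : nat) (p : grid_point) :
  (i < k)%N -> p + d *+ i \in run d k p.
Proof. by move=> ik; apply/imfsetP; exists i; rewrite //= mem_iota. Qed.

(** If [i < j], then [p - d] equals [q + d *+ (j - i - 1)], a point of the run of [q] and hence of
    [P], which contradicts the maximality at [p]. *)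
Lemma maximal_run_disjoint (P : {fset grid_point}) (d : grid_point) (k i j : nat)
    (p q : grid_point) :
  maximal_run P d k p -> maximal_run P d k q -> (i < k)%N -> (j < k)%N ->
  p + d *+ i = q + d *+ j -> i = j /\ p = q.
Proof.
wlog ij : i j p q / (i <= j)%N => [hw|] pmax qmax ik jk e.
  case/orP: (leq_total i j) => h; first exact: hw.
  by have [-> ->] := hw j i q p h qmax pmax jk ik (esym e).
move: ij; rewrite leq_eqVlt => /predU1P[ij|ij].
  by split=> //; move: e; rewrite ij => /addIr.
case/and3P: pmax => _ /negP[]; case/and3P: qmax => /fsubsetP qP _ _.
have -> : p - d = q + d *+ (j - i).-1.
  apply: (addIr (d *+ i.+1)); rewrite -[RHS]addrA -mulrnDr.
  have -> : ((j - i).-1 + i.+1 = j)%N by lia.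
  by rewrite -e mulrS addrA subrK.
by apply/qP/mem_run; lia.
Qed.

Lemma card_segments (P : {fset grid_point}) (d : grid_point) (k : nat) :
  (0 < k)%N ->
  #|` segments P d k| = #|` [fset p in P | maximal_run P d k p]%fset|.
Proof.
move=> k_gt0; rewrite card_in_imfset /=; last first.
  move=> p q /andP[_ pmax] /andP[_ qmax] e.
  have : p + d *+ 0 \in run d k q by rewrite -e mem_run.
  move=> /imfsetP[i]; rewrite /= mem_iota => /andP[_ ik].
  by move/(maximal_run_disjoint pmax qmax k_gt0 ik) => [].
by apply/esym/card_imfset.
Qed.

(** By disjointness, pairs of a starting point and an offset below [k] inject into [P]. *)
Lemma card_segments_le (P : {fset grid_point}) (d : grid_point) (k : nat) :
  (0 < k)%N -> (k * #|` segments P d k| <= #|` P|)%N.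
Proof.
move=> k_gt0; rewrite card_segments //; set T := [fset p in P | _]%fset.
pose g (x : T * 'I_k) := val x.1 + d *+ x.2.
have Tmax (p : T) : maximal_run P d k (val p).
  by have := valP p; rewrite !inE /= => /andP[].
have g_inj : injective g.
  move=> [p i] [q j] /(maximal_run_disjoint (Tmax p) (Tmax q) (ltn_ord i) (ltn_ord j)).
  by move=> [/val_inj -> /val_inj ->].
have <- : #|` [fset g x | x : T * 'I_k]%fset| = (k * #|` T|)%N.
  by rewrite card_imfset //= -cardE card_prod card_ord mulnC cardfE.
apply/fsubset_leq_card/fsubsetP => _ /imfsetP[[p i] _ ->].
by case/and3P: (Tmax p) => /fsubsetP + _ _; apply; apply: mem_run.
Qed.

Lemma nb_segments_le (P : {fset grid_point}) (k : nat) :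
  (0 < k)%N -> (k * nb_segments k P <= 4 * #|` P|)%N.
Proof.
move=> k_gt0; rewrite big_distrr /=.
apply: (@leq_trans (\sum_(d <- directions) #|` P|)%N).
  by apply: leq_sum => d _; apply: card_segments_le.
by rewrite big_const_seq iter_addn_0 mulnC.
Qed.

(** * The periodic construction *)

(* The coordinates are (x + 2 y, y), with x + 2 y written as a quotient and a
   nonzero remainder modulo k + 1. *)
Definition sheared_point (k A B : nat) (x : 'I_A * 'I_k * 'I_B) : grid_point :=
  ((k.+1 * x.1.1 + x.1.2.+1)%N%:Z - (x.2 : nat)%:Z *+ 2, (x.2 : nat)%:Z).

Definition sheared_box (k A B : nat) : {fset grid_point} :=
  [fset sheared_point x | x : 'I_A * 'I_k * 'I_B]%fset.

Lemma card_sheared_box (k A B : nat) : (#|` sheared_box k A B| <= k * A * B)%N.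
Proof.
apply: leq_trans (leq_imfset_card _ _ _) _.
by rewrite /= -cardE !card_prod !card_ord (mulnC k).
Qed.

Lemma mem_sheared_box (k A B : nat) (x y : int) :
  ((x, y) \in sheared_box k A B) =
    [&& 0 <= y < B%:Z, 0 <= x + y *+ 2 < (k.+1 * A)%N%:Z
      & ~~ (k.+1 %| x + y *+ 2)%Z].
Proof.
apply/imfsetP/idP => [[[[t i] j] _ /= [-> ->]]|].
  have := ltn_ord t; have := ltn_ord i; have := ltn_ord j => jB ik tA.
  rewrite subrK; apply/and3P; split; [by lia|by nia|].
  rewrite (_ : (_ %| _)%Z = (k.+1 %| k.+1 * t + i.+1)%N) //.
  by rewrite dvdn_addr ?dvdn_mulr // gtnNdvd.
case: y => // y; case e: (x + _) => [u|u] /and3P[yB uA]; last lia.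
rewrite (_ : (_ %| _)%Z = (k.+1 %| u)%N) // => du.
have yB' : (y < B)%N by lia.
have tA : (u %/ k.+1 < A)%N by rewrite ltn_divLR // mulnC; lia.
have r0 : (0 < u %% k.+1)%N by rewrite lt0n.
have rk : ((u %% k.+1).-1 < k)%N by have := ltn_pmod u (ltn0Sn k); lia.
exists (Ordinal tA, Ordinal rk, Ordinal yB') => //=.
rewrite /sheared_point /= prednK // mulnC -divn_eq -e; congr pair; lia.
Qed.

(** Coprimality makes the holes on each line [k + 1] steps apart; the bounds on the increments of
    [y] and [x + 2 y] determine the margins of the box. *)
Lemma directions_coprime (d : grid_point) (k : nat) : coprime (k + 1)%N 6 ->
  d \in directions ->
  [&& -1 <= d.2 <= 1, -1 <= d.1 + d.2 *+ 2 <= 3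
    & coprimez k.+1 (d.1 + d.2 *+ 2)].
Proof.
rewrite addn1 (coprimeMr _ 2 3) => /andP[c2 c3].
by rewrite !inE => /or4P[] /eqP -> /=; rewrite /coprimez /gcdz /= ?gcdn1 //;
   apply/eqP; congr Posz; apply/eqP.
Qed.

Lemma pair_mulrn (d : grid_point) (i : nat) : d *+ i = (d.1 *+ i, d.2 *+ i).
Proof. by elim: i => // i IH; rewrite !mulrSr IH. Qed.

Lemma card_segments_sheared_box (d : grid_point) (k N : nat) :
  coprime (k + 1)%N 6 -> (0 < k)%N -> d \in directions ->
  (N * N <= #|` segments (sheared_box k (N + 4) (N + k.+1.*2)) d k|)%N.
Proof.
move=> c6 k_gt0 /(directions_coprime c6)/and3P[d2 d12 cop].
rewrite card_segments //; set P := sheared_box _ _ _.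
(* Maximal runs join consecutive points of the removed lattice
   x + 2 y = 0 mod (k + 1); [hole] enumerates those far from the boundary. *)
pose hole (x : 'I_N * 'I_N) : grid_point :=
  ((k.+1 * x.1.+1)%N%:Z - (k.+1 + x.2)%N%:Z *+ 2, (k.+1 + x.2)%N%:Z).
have holeE x i : (i <= k.+1)%N -> (hole x + d *+ i \in P) = (0 < i < k.+1)%N.
  move=> ik; case: x => s r; have := ltn_ord s; have := ltn_ord r => rN sN.
  rewrite [X in X \in _]surjective_pairing mem_sheared_box pair_mulrn /=.
  have -> : (k.+1 * s.+1)%N%:Z - (k.+1 + r)%N%:Z *+ 2 + d.1 *+ i
      + ((k.+1 + r)%N%:Z + d.2 *+ i) *+ 2 =
    (k.+1 * s.+1)%N%:Z + (d.1 + d.2 *+ 2) * i%:Z by lia.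
  rewrite rpredDl; last by rewrite PoszM dvdz_mulr.
  (* The increment is a unit modulo [k + 1], so only [i] decides divisibility. *)
  rewrite Gauss_dvdzr //.
  (* In at most [k + 1] steps [y] moves by at most [k + 1] either way, and [x + 2 y] falls by at
     most [k + 1] or rises by at most [3 (k + 1)]; hence the margins [k.+1.*2] and [4]. *)
  have -> : 0 <= (k.+1 + r)%N%:Z + d.2 *+ i < (N + k.+1.*2)%N%:Z by nia.
  have -> : 0 <= (k.+1 * s.+1)%N%:Z + (d.1 + d.2 *+ 2) * i%:Z
      < (k.+1 * (N + 4))%N%:Z by nia.
  rewrite /= (_ : (_ %| _)%Z = (k.+1 %| i)%N) //.
  case: (posnP i) => [->|i0]; first by rewrite dvdn0.
  move: ik; rewrite leq_eqVlt => /predU1P[->|ik]; first by rewrite dvdnn ltnn.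
  by rewrite gtnNdvd.
pose start x := hole x + d.
have startE x i : start x + d *+ i = hole x + d *+ i.+1.
  by rewrite /start mulrS addrA.
have start_inj : injective start.
  move=> [s r] [s' r'] /addIr[] e1 e2.
  by congr pair; apply: val_inj => /=; nia.
have <- : #|` [fset start x | x : 'I_N * 'I_N]%fset| = (N * N)%N.
  by rewrite card_imfset //= -cardE card_prod card_ord.
apply/fsubset_leq_card/fsubsetP => _ /imfsetP[x _ ->].
have startP i : (i < k)%N -> start x + d *+ i \in P.
  by move=> ik; rewrite startE holeE //; lia.
rewrite !inE /= -{1}[start x]addr0 -(mulr0n d) startP //=.
apply/and3P; split.
- apply/fsubsetP => q /imfsetP[i]; rewrite /= mem_iota => /andP[_ ik] ->.
  exact: startP.
- by rewrite /start addrK -[hole x]addr0 -(mulr0n d) holeE.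
- by rewrite startE holeE // ltnn andbF.
Qed.

(** * Bounds on [min_points] and the limit *)

Lemma min_points_lower (k n : nat) : (0 < k)%N ->
  (k * n <= 4 * min_points k n)%N.
Proof.
move=> k_gt0; have [[P <- nP] _] := min_points_min n k_gt0.
by apply: leq_trans (nb_segments_le P k_gt0); rewrite leq_mul2l nP orbT.
Qed.

Lemma min_points_upper (k n N : nat) : coprime (k + 1)%N 6 -> (0 < k)%N ->
  (n <= 4 * (N * N))%N ->
  (min_points k n <= k * (N + 4) * (N + k.+1.*2))%N.
Proof.
move=> c6 k_gt0 nN; have [_ min_le] := min_points_min n k_gt0.
apply: leq_trans (card_sheared_box k (N + 4) (N + k.+1.*2)).
apply: min_le; apply: leq_trans nN _.
rewrite /nb_segments big_seq.
apply: leq_trans (_ : (\sum_(d <- directions | d \in directions) N * N <= _)%N).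
  by rewrite -big_seq big_const_seq iter_addn_0 mulnC.
by apply: leq_sum => d dP; apply: card_segments_sheared_box.
Qed.

(** Take the least [N] with [n <= 4 N^2]; minimality gives [4 (N - 1)^2 < n], from which the other
    two bounds follow. *)
Lemma half_sqrt_up (n : nat) : (0 < n)%N ->
  exists N, [/\ n <= 4 * (N * N), 4 * (N * N) <= n + 8 * N & N * N <= n]%N.
Proof.
move=> n0; have ex : exists N, (n <= 4 * (N * N))%N by exists n; nia.
case: (ex_minnP ex) => -[|N] nN minN; first by lia.
have : (4 * (N * N) < n)%N by rewrite ltnNge; apply/negP => /minN; rewrite ltnn.
by exists N.+1; split=> //; nia.
Qed.

Lemma min_points_upper_sqrt (k n : nat) :
  coprime (k + 1)%N 6 -> (0 < k)%N -> (0 < n)%N ->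
  exists2 N, (N * N <= n)%N &
    (4 * min_points k n <= k * (n + (64 + 40 * k) * N))%N.
Proof.
move=> c6 k0 n0; have [N [nN Nn N2]] := half_sqrt_up n0; exists N => //.
have := min_points_upper c6 k0 nN; move/(leq_mul (leqnn 4))/leq_trans; apply.
(* Expanding, [4 (N + 4) (N + 2 k + 2) = 4 N^2 + (8 k + 24) N + 32 k + 32]. With [4 N^2 <= n + 8 N]
   and [1 <= N] this is at most [n + (64 + 40 k) N]. *)
rewrite -mulnA mulnCA leq_pmul2l // -muln2.
have : (0 < N)%N by lia.
nia.
Qed.

Theorem corollary1 (R : realType) (k : nat) (k_ge1 : (1 <= k)%N)
    (k1_coprime6 : coprime (k + 1)%N 6) :
  cvgn (points_per_segment R k) /\ f R k = k%:R / 4.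
Proof.
suff cv : points_per_segment R k @ \oo --> (k%:R / 4 : R).
  by split; [apply/cvg_ex; exists (k%:R / 4)|apply: cvg_lim].
(* The shift avoids division by zero at [n = 0] and matches [harmonic n = 1 / (n + 1)]. *)
rewrite -cvg_shiftS /=.
pose c : R := (k * (64 + 40 * k))%:R / 4.
(* The error is at most [c N / (n + 1)], and [N <= sqrt (n + 1)]. *)
pose ub n : R := k%:R / 4 + c * Num.sqrt (harmonic n).
apply: (@squeeze_cvgr _ _ _ _ (fun=> k%:R / 4) ub).
- near=> n.
  have n0 : 0 < n.+1%:R :> R by rewrite ltr0n.
  rewrite /points_per_segment ler_pdivlMr // ler_pdivrMr //; apply/andP; split.
    have := min_points_lower n.+1 k_ge1; rewrite -(ler_nat R) !natrM; lra.
  have [N N2 hN] := min_points_upper_sqrt k1_coprime6 k_ge1 (ltn0Sn n).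
  have sE : Num.sqrt (harmonic n) * n.+1%:R = Num.sqrt n.+1%:R :> R.
    rewrite /harmonic sqrtrV ?ler0n // -{2}[n.+1%:R]sqr_sqrtr ?ler0n // expr2.
    by rewrite mulKf // gt_eqF // sqrtr_gt0.
  have NS : N%:R <= Num.sqrt n.+1%:R :> R.
    by rewrite -[leLHS]normr_nat -sqrtr_sqr ler_sqrt ?ler0n // expr2 -natrM ler_nat.
  rewrite /ub mulrDl -(mulrA c) sE.
  have c0 : 0 <= c by rewrite divr_ge0.
  have := ler_wpM2l c0 NS.
  move: hN; rewrite -(ler_nat R) !(natrM, natrD) /c !(natrM, natrD); nra.
- exact: cvg_cst.
- have sqrt0 : Num.sqrt (harmonic n) @[n --> \oo] --> (0 : R).
    rewrite -[X in _ --> X](@sqrtr0 R).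
    apply: (cvg_comp (@harmonic R) (@Num.sqrt R)); first exact: cvg_harmonic.
    exact: sqrt_continuous.
  rewrite -[X in _ --> X]addr0 -(mulr0 c).
  by apply: cvgD; [exact: cvg_cst|apply: cvgM => //; exact: cvg_cst].
Unshelve. all: by end_near.
Qed.
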